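(* Fix an imprecise probability tree $(\overline{\mathrm Q}_s)_{s\in\mathscr X^\ast}$ with corresponding global upper expectation $\overline{\mathrm E}_{\mathrm V}$. For any situation $s\in\mathscr X^\ast$ and any (pointwise) non-decreasing sequence $\{f_n\}_{n\in\mathbb N_0}$ in $\overline{\mathbb V}_b$ that converges point-wise to a variable $f\in\overline{\mathbb V}_b$, $$\overline{\mathrm E}_{\mathrm V}(f\vert s)=\lim_{n\to+\infty}\overline{\mathrm E}_{\mathrm V}(f_n\vert s).$$
   Context: $\overline{\mathbb R}=\mathbb R\cup\{+\infty,-\infty\}$, $\mathbb N=\{1,2,\dots\}$, $\mathbb N_0=\mathbb N\cup\{0\}$. Conventions: $+\infty-\infty=-\infty+\infty=+\infty$, $0\cdot(\pm\infty)=0$, otherwise the usual arithmetic on $\overline{\mathbb R}$. For a non-empty set $\mathscr Y$, $\overline{\mathscr L}_b(\mathscr Y)$ is the set of all maps $f\colon\mathscr Y\to\overline{\mathbb R}$ that are bounded below (there is $M\in\mathbb R$ with $f\ge M$). An upper expectation on $\overline{\mathscr L}_b(\mathscr Y)$ is a map $\overline{\mathrm E}\colon\overline{\mathscr L}_b(\mathscr Y)\to\overline{\mathbb R}$ such that: (E1) $\overline{\mathrm E}(c)=c$ for all constants $c\in\mathbb R$; (E2) $\overline{\mathrm E}(f+g)\le\overline{\mathrm E}(f)+\overline{\mathrm E}(g)$ for all $f,g$; (E3) $\overline{\mathrm E}(\lambda f)=\lambda\overline{\mathrm E}(f)$ for all $\lambda\in(0,+\infty)\cup\{+\infty\}$ and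 all non-negative $f$; (E4) $f\le g$ implies $\overline{\mathrm E}(f)\le\overline{\mathrm E}(g)$. $\mathscr X$ is a fixed non-empty finite set (state space). A situation is a finite string $x_{1:n}=(x_1,\dots,x_n)\in\mathscr X^n$, $n\in\mathbb N_0$ (the empty string is denoted $\Box$); $\mathscr X^\ast$ is the set of all situations; $sx$ is the string $s$ followed by $x\in\mathscr X$. $\Omega=\mathscr X^{\mathbb N}$ is the set of paths; for $\omega\in\Omega$, $\omega^n$ is the string of its first $n$ entries. $\Gamma(s)$ is the set of all paths that start with the string $s$. $\overline{\mathbb V}$ is the set of all maps $\Omega\to\overline{\mathbb R}$ and $\overline{\mathbb V}_b=\overline{\mathscr L}_b(\Omega)$. For $f,g\in\overline{\mathbb V}$, $f\ge_s g$ means $f(\omega)\ge g(\omega)$ for all $\omega\in\Gamma(s)$. An imprecise probability tree assigns to every $s\in\mathscr X^\ast$ an upper expectation $\overline{\mathrm Q}_s$ on $\overline{\mathscr L}_b(\mathscr X)$. A supermartingale (for the given tree) is a map $\mathscr M\colon\mathscr X^\ast\to\overline{\mathbb R}$ that is bounded below by a real constant and satisfies $\overline{\mathrm Q}_s(\mathscr M(s\,\cdot))\le\mathscr M(s)$ for all $s\in\mathscr X^\ast$, where $\mathscr M(s\,\cdot)(x)=\mathscr M(sx)$. $\overline{\mathbb M}_{\mathrm b}$ is the set of all supermartingales, and $\liminf\mathscr M(\omega):=\liminf_{n\to+\infty}\mathscr M(\omega^n)$. The global upper expectation is, for $f\in\overline{\mathbb V}$ and $s\in\mathscr X^\ast$,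 $$\overline{\mathrm E}_{\mathrm V}(f\vert s):=\inf\{\mathscr M(s)\colon\mathscr M\in\overline{\mathbb M}_{\mathrm b}\text{ and }\liminf\mathscr M\ge_s f\}.$$ *)

(* Defs.v *)
From HB Require Import structures.
From mathcomp Require Import all_boot all_order all_algebra.
From mathcomp Require Import all_classical all_reals all_analysis.

Set Implicit Arguments.
Unset Strict Implicit.
Unset Printing Implicit Defensive.

Import Order.TTheory GRing.Theory Num.Theory.
Import numFieldNormedType.Exports.

Local Open Scope classical_set_scope.
Local Open Scope ring_scope.
Local Open Scope ereal_scope.

Definition bounded_below (R : realType) (Y : Type) (f : Y -> \bar R) : Prop :=
  exists m : R, forall y, m%:E <= f y.

(* An operator on bounded-below maps is encoded as a total operator [E] of
   which only the values at bounded-below maps are constrained or used.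
   The dual addition [%dE] implements the convention +oo - oo = +oo. *)
Record upper_expectation (R : realType) (Y : Type)
    (E : (Y -> \bar R) -> \bar R) : Prop := UpperExpectation {
  upper_expectation_cst : forall c : R, E (fun=> c%:E) = c%:E ;
  upper_expectation_subadd : forall f g : Y -> \bar R,
    bounded_below f -> bounded_below g ->
    E (fun y => (f y + g y)%dE) <= (E f + E g)%dE ;
  upper_expectation_scale : forall (l : \bar R) (f : Y -> \bar R),
    0 < l -> bounded_below f -> (forall y, 0 <= f y) ->
    E (fun y => l * f y) = l * E f ;
  upper_expectation_mono : forall f g : Y -> \bar R,
    bounded_below f -> bounded_below g -> (forall y, f y <= g y) ->
    E f <= E g }.

Definition situation (X : finType) : Type := seq X.

(* The entries of a path are numbered from 0. *)
Definition path_space (X : finType) : Type := nat -> X.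

Definition path_prefix (X : finType) (w : path_space X) (n : nat) :
  situation X := mkseq w n.

Definition cylinder (X : finType) (s : situation X) : set (path_space X) :=
  [set w | path_prefix w (size s) = s].

Definition local_models (R : realType) (X : finType) : Type :=
  situation X -> (X -> \bar R) -> \bar R.

Definition imprecise_probability_tree (R : realType) (X : finType)
    (Q : local_models R X) : Prop :=
  forall s, upper_expectation (Q s).

Definition supermartingale (R : realType) (X : finType)
    (Q : local_models R X) (M : situation X -> \bar R) : Prop :=
  bounded_below M /\ forall s, Q s (fun x => M (rcons s x)) <= M s.

Definition path_liminf (R : realType) (X : finType)
    (M : situation X -> \bar R) (w : path_space X) : \bar R :=
  limn_einf (fun n => M (path_prefix w n)).

Definition global_upper_expectation (R : realType) (X : finType)
    (Q : local_models R X) (f : path_space X -> \bar R) (s : situation X) :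
    \bar R :=
  ereal_inf [set M s | M in [set M : situation X -> \bar R |
    supermartingale Q M /\
    forall w, cylinder s w -> f w <= path_liminf M w]].

(* Main.v *)
(* By adding a constant one may take [f_ 0 >= 1]. Write [E_ n t] for the global
   upper expectation of [f_ n] in [t], fix [a > 1], and let [N u] be a
   supermartingale with [N u u <= a * E_ n u] whose inferior limit dominates
   [f_ n] on the paths through [u]. Start with [N] at the root and, whenever the
   currently played [N u] satisfies [a * N v v < N u v] at the present situation
   [v], switch to [N v] with the stake multiplied by [a], which costs nothing.
   As all [N u] are at least 1 beyond [u], the resulting supermartingale [K_ n]
   tends to [+oo] along a path with infinitely many switches; along any other
   path eventually [N u v <= a * N v v <= a ^+ 2 * E_ n v] for a fixed [u], so
   [f_ n <= a ^+ 2 * liminf E_ n] there. This is Levy's zero-one law.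
   The upper expectations on the finite set [X] are continuous along
   non-decreasing sequences, so the supremum over [n] of
   [a ^+ 2 * E_ n + \sum_(i < n) d_ i * K_ i] is a supermartingale; its inferior
   limit dominates every [f_ n], and for small weights [d_ i] and [a] close to 1
   its value in [s] is close to the supremum of the [E_ n s]. *)
Require Import Defs.
From mathcomp Require Import all_boot all_order all_algebra.
From mathcomp Require Import all_classical all_reals all_analysis.
From mathcomp Require Import ring lra.

Set Implicit Arguments.
Unset Strict Implicit.
Unset Printing Implicit Defensive.

Import Order.TTheory GRing.Theory Num.Theory.
Import numFieldNormedType.Exports.

Local Open Scope classical_set_scope.
Local Open Scope ring_scope.
Local Open Scope ereal_scope.

(** * Inferior limits in the extended reals *)

Section limn_einf_order.
Context (R : realType).
Implicit Types u v : (\bar R)^nat.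

Lemma limn_einf_ereal_sup u : limn_einf u = ereal_sup (range (einfs u)).
Proof. by rewrite limn_einf_lim; apply/cvg_lim => //; exact: cvg_einfs_sup. Qed.

Lemma near_le_limn_einf u v : (\forall n \near \oo, u n <= v n) ->
  limn_einf u <= limn_einf v.
Proof.
move=> [N _ uv]; rewrite !limn_einf_ereal_sup; apply: ge_ereal_sup => _ [n _ <-].
apply: le_ereal_sup_tmp; exists (einfs v (maxn n N)); first by exists (maxn n N).
apply: (le_trans (nondecreasing_einfs u (leq_maxl n N))).
apply: le_ereal_inf_tmp => _ [m /= nNm <-].
apply: le_trans (uv m _); last exact: leq_trans (leq_maxr n N) nNm.
by apply: ereal_inf_lbound; exists m.
Qed.

Lemma limn_einf_cst (b : \bar R) : limn_einf (fun=> b) = b.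
Proof. exact: (cvg_limn_einf_sup (cvg_cst b)).1. Qed.

Lemma limn_einf_le (b : \bar R) u :
  (\forall n \near \oo, u n <= b) -> limn_einf u <= b.
Proof. by move=> ub; rewrite -[leRHS](limn_einf_cst b); exact: near_le_limn_einf. Qed.

Lemma limn_einf_pinfty u :
  (forall A : R, \forall n \near \oo, A%:E <= u n) -> limn_einf u = +oo.
Proof. by move=> /cvgeyPge uy; exact: (cvg_limn_einf_sup uy).1. Qed.

End limn_einf_order.

Lemma ge0_bounded_below (R : realType) (Y : Type) (h : Y -> \bar R) :
  (forall y, 0 <= h y) -> bounded_below h.
Proof. by exists 0%R. Qed.

(** * Bounds for a single upper expectation *)

Section upper_expectation.
Context (R : realType) (Y : Type) (E : (Y -> \bar R) -> \bar R).
Hypothesis uE : upper_expectation E.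
Implicit Types h g : Y -> \bar R.

Lemma upper_expectation_ge (c : \bar R) h : bounded_below h -> c != -oo ->
  (forall y, c <= h y) -> c <= E h.
Proof.
move=> bh; case: c => // [r|] _ ch.
  rewrite -(upper_expectation_cst uE r).
  by apply: (upper_expectation_mono uE) => //; exists r.
rewrite leye_eq; apply/eqP/eqyP => r _; rewrite -(upper_expectation_cst uE r).
apply: (upper_expectation_mono uE) => //; first by exists r.
by move=> y; rewrite (le_trans _ (ch y))// leey.
Qed.

Lemma upper_expectation_ge0 h : (forall y, 0 <= h y) -> 0 <= E h.
Proof. by move=> h0; apply: upper_expectation_ge => //; exact: ge0_bounded_below. Qed.

Lemma ge0_upper_expectation_mono h g :
  (forall y, 0 <= h y) -> (forall y, h y <= g y) -> E h <= E g.
Proof.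
move=> h0 hg; have g0 y : 0 <= g y by exact: le_trans (h0 y) (hg y).
by apply: (upper_expectation_mono uE) => //; exact: ge0_bounded_below.
Qed.

(** On non-negative maps [+oo - oo] cannot occur, so the dual sum in the subadditivity axiom is the
    ordinary one. *)
Lemma ge0_upper_expectation_subadd h g :
  (forall y, 0 <= h y) -> (forall y, 0 <= g y) ->
  E (fun y => h y + g y) <= E h + E g.
Proof.
move=> h0 g0.
have -> : (fun y => h y + g y) = (fun y => (h y + g y)%dE).
  by apply/funext => y; rewrite DualAddTheoryNumDomain.dual_addeE_def// ge0_adde_def// inE.
rewrite (le_trans (upper_expectation_subadd uE _ _))//;
  try exact: ge0_bounded_below.
by rewrite DualAddTheoryNumDomain.dual_addeE_def// ge0_adde_def// inE upper_expectation_ge0.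
Qed.

End upper_expectation.

(** * Continuity of upper expectations on a finite set *)

Section upper_expectation_continuity.
Context (R : realType) (Y : finType) (E : (Y -> \bar R) -> \bar R).
Hypothesis uE : upper_expectation E.

(** The points where the supremum [H] is infinite, with indicator [B], are treated apart. If
    [E B = 0], scaling by [+oo] still gives [0], so [H] is dominated by some [h n + e] plus the null
    term [+oo * B]. If [E B > 0], the [h n] dominate arbitrarily large multiples of [B] and force
    [b = +oo]. *)
Lemma upper_expectation_sup_le (h : nat -> Y -> \bar R) (b : \bar R) :
  (forall n y, 0 <= h n y) ->
  (forall y, {homo (fun n => h n y) : m n / (m <= n)%N >-> m <= n}) ->
  (forall n, E (h n) <= b) ->
  E (fun y => ereal_sup (range (h ^~ y))) <= b.
Proof.
move=> h0 hnd hb; set H := fun y => ereal_sup _.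
have hH n y : h n y <= H y by apply: ereal_sup_ubound; exists n.
have H0 y : 0 <= H y by exact: le_trans (h0 0%N y) (hH 0%N y).
(* Finiteness of [Y] turns pointwise indices into a common one, their maximum. *)
have uniform (P : Y -> \bar R -> Prop) :
    (forall y r r', r <= r' -> P y r -> P y r') ->
    (forall y, exists n, P y (h n y)) -> exists n, forall y, P y (h n y).
  move=> Pmono /choice[n_ Pn_]; exists (\max_y n_ y)%N => y.
  by apply: Pmono (Pn_ y); apply: hnd; exact: leq_bigmax.
pose B y : \bar R := if H y == +oo then 1 else 0.
have B0 y : 0 <= B y by rewrite /B; case: ifP.
have EB0 : 0 <= E B by exact: upper_expectation_ge0.
have b0 : 0 <= b by apply: le_trans (hb 0%N); exact: upper_expectation_ge0.
have [EB|EBn0] := eqVneq (E B) 0.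
  apply/lee_addgt0Pr => e e0.
  have [n Hn] : exists n, forall y, H y <= h n y + e%:E + +oo * B y.
    apply: (uniform (fun y r => H y <= r + e%:E + +oo * B y)).
      by move=> y r r' rr' /le_trans; apply; rewrite leeD2r// leeD2r.
    move=> y; rewrite /B; case: ifPn => Hy.
      exists 0%N; rewrite mule1 addey ?leey//.
      by rewrite gt_eqF// (lt_le_trans ltNy0)// adde_ge0// lee_fin ltW.
    have Hfin : H y \is a fin_num by rewrite ge0_fin_numE// lt_neqAle Hy leey.
    have [_ [n _ <-] Hn] := @ub_ereal_sup_adherent _ (range (h ^~ y)) e e0 Hfin.
    by exists n; rewrite mule0 adde0 -leeBlDr// ltW.
  have e0' : 0 <= e%:E by rewrite lee_fin ltW.
  have he0 y : 0 <= h n y + e%:E by rewrite adde_ge0.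
  have oB0 y : 0 <= +oo * B y by rewrite mule_ge0.
  rewrite (le_trans (ge0_upper_expectation_mono uE H0 Hn))//.
  rewrite (le_trans (ge0_upper_expectation_subadd uE he0 oB0))//.
  rewrite (upper_expectation_scale uE)//; last exact: ge0_bounded_below.
  rewrite EB mule0 adde0 (le_trans (ge0_upper_expectation_subadd uE _ _))//.
  by rewrite (upper_expectation_cst uE) leeD2r.
have EBgt0 : 0 < E B by rewrite lt_neqAle eq_sym EBn0.
suff -> : b = +oo by rewrite leey.
apply/eqyP => A A0.
have EBfin : E B \is a fin_num.
  rewrite ge0_fin_numE// (@le_lt_trans _ _ 1) ?ltry//.
  rewrite -(upper_expectation_cst uE 1) ge0_upper_expectation_mono// => y.
  by rewrite /B; case: ifP.
(* With this choice [c * E B = A], so [c * B <= h n] yields [A <= E (h n) <= b]. *)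
pose c := (A / fine (E B))%R.
have c0 : (0 < c)%R by rewrite divr_gt0// fine_gt0// EBgt0 ltey_eq EBfin.
have [n Hn] : exists n, forall y, c%:E * B y <= h n y.
  apply: (uniform (fun y r => c%:E * B y <= r)).
    by move=> y r r' rr' /le_trans; apply.
  move=> y; rewrite /B; case: ifPn => [/eqP Hy|_]; last by exists 0%N; rewrite mule0.
  rewrite mule1; have : c%:E < H y by rewrite Hy ltry.
  by move=> /ereal_sup_gt[_ [n _ <-] cn]; exists n; exact: ltW.
apply: le_trans (hb n).
have -> : A%:E = c%:E * E B.
  by rewrite -[in RHS](fineK EBfin) -EFinM divfK// gt_eqF// fine_gt0// EBgt0 ltey_eq EBfin.
rewrite -(upper_expectation_scale uE)//; last exact: ge0_bounded_below.
by apply: ge0_upper_expectation_mono => // y; rewrite mule_ge0// lee_fin ltW.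
Qed.

End upper_expectation_continuity.

(** * Paths, prefixes and cylinders *)

Section paths.
Context (X : finType).
Implicit Types (w : path_space X) (t u : situation X).

Lemma path_prefixS w n : path_prefix w n.+1 = rcons (path_prefix w n) (w n).
Proof. exact: mkseqS. Qed.

Lemma cylinder_path_prefix w n : cylinder (path_prefix w n) w.
Proof. by rewrite /cylinder /= /path_prefix size_mkseq. Qed.

Lemma cylinder_prefix u t w : prefix u t -> cylinder t w -> cylinder u w.
Proof.
rewrite /cylinder /= => ut tw; have sut := size_prefix ut.
move: ut; rewrite prefixE => /eqP tu.
rewrite -[RHS]tu -[in RHS]tw /path_prefix /mkseq.
by rewrite -map_take take_iota (minn_idPl sut).
Qed.

Lemma exists_path_through (next : situation X -> X) t :
  exists w, forall k,
    path_prefix w (size t + k) = iter k (fun u => rcons u (next u)) t.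
Proof.
pose T k := iter k (fun u => rcons u (next u)) t; have x0 := next t.
have sizeT k : size (T k) = (size t + k)%N.
  by elim: k => [|k IH]; rewrite ?addn0//= size_rcons IH addnS.
have nthT i k j : (i < size (T k))%N -> nth x0 (T (k + j)%N) i = nth x0 (T k) i.
  move=> ik; elim: j => [|j IH]; first by rewrite addn0.
  rewrite addnS /= nth_rcons -/(T _) IH sizeT ifT//.
  by rewrite (leq_trans ik)// sizeT addnA leq_addr.
(* The length [size t + i.+1] of [T i.+1] exceeds [i], and later iterates only append, so all long
   enough iterates agree at [i]; [x0] is a mere default. *)
exists (fun i => nth x0 (T i.+1) i) => k; apply: (@eq_from_nth _ x0).
  by rewrite size_mkseq -/(T k) sizeT.
move=> i; rewrite size_mkseq => ik; rewrite nth_mkseq// -/(T k).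
have iT : (i < size (T i.+1))%N by rewrite sizeT addnS ltnS leq_addl.
by rewrite -(nthT i i.+1 k iT) addnC nthT// sizeT.
Qed.

End paths.

(** * Supermartingales and the global upper expectation *)

Section supermartingales.
Context (R : realType) (X : finType) (X_nonempty : (0 < #|X|)%N).
Context (Q : local_models R X) (treeQ : imprecise_probability_tree Q).
Implicit Types (M : situation X -> \bar R) (t u : situation X).
Implicit Types (f : path_space X -> \bar R) (w : path_space X).

Local Notation EV := (global_upper_expectation Q).

(** An upper expectation is at least the minimum of its argument, which is attained at some child
    because [X] is finite. *)
Lemma supermartingale_child_le M t :
  supermartingale Q M -> exists x, M (rcons t x) <= M t.
Proof.
move=> [[m mM] QM]; have /card_gt0P[x0 _] := X_nonempty.
have [x _ xmin] := @arg_minP _ _ _ x0 xpredT (fun x => M (rcons t x)) isT.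
exists x; apply: le_trans (QM t); apply: (upper_expectation_ge (treeQ t)).
- by exists m.
- by rewrite gt_eqF// (lt_le_trans (ltNyr m)).
- by move=> y; exact: xmin.
Qed.

(** Always moving to a child where [M] does not grow gives a path through [t] along which [M] stays
    below [M t]. *)
Lemma supermartingale_ge_liminf M t (b : \bar R) : supermartingale Q M ->
  (forall w, cylinder t w -> b <= path_liminf M w) -> b <= M t.
Proof.
move=> smM bM.
have /choice[next Mnext] := fun u => supermartingale_child_le u smM.
have [w wt] := exists_path_through next t.
have Mw k : M (path_prefix w (size t + k)) <= M t.
  by rewrite wt; elim: k => //= k IH; exact: le_trans (Mnext _) IH.
have tw : cylinder t w by rewrite /cylinder /= -(addn0 (size t)) wt.
apply: le_trans (bM _ tw) _; apply: limn_einf_le; exists (size t) => // n /= tn.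
by rewrite -(subnKC tn).
Qed.

Lemma global_upper_expectation_ge f t (b : \bar R) :
  (forall w, cylinder t w -> b <= f w) -> b <= EV f t.
Proof.
move=> bf; apply: le_ereal_inf_tmp => _ [M [smM fM] <-].
by apply: supermartingale_ge_liminf => // w tw; exact: le_trans (bf _ tw) (fM _ tw).
Qed.

Lemma global_upper_expectation_mono f g t :
  (forall w, f w <= g w) -> EV f t <= EV g t.
Proof.
move=> fg; apply: le_ereal_inf_tmp => _ [M [smM gM] <-].
apply: ereal_inf_lbound; exists M => //.
by split=> // w tw; exact: le_trans (fg w) (gM w tw).
Qed.

(** A supermartingale competing in the infimum at [t] also competes at every child, whose cylinder
    is smaller; its local inequality at [t] thus passes to the infimum. *)
Lemma global_upper_expectation_supermartingale f :
  (forall w, 0 <= f w) -> supermartingale Q (EV f).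
Proof.
move=> f0; have E0 t : 0 <= EV f t by exact: global_upper_expectation_ge.
split=> [|t]; first exact: ge0_bounded_below.
apply: le_ereal_inf_tmp => _ [M [smM fM] <-].
apply: le_trans (smM.2 t); apply: ge0_upper_expectation_mono => // x.
apply: ereal_inf_lbound; exists M => //.
by split=> // w txw; apply: fM; apply: cylinder_prefix txw; exact: prefix_rcons.
Qed.

Lemma supermartingaleD M M' : (forall t, 0 <= M t) -> (forall t, 0 <= M' t) ->
  supermartingale Q M -> supermartingale Q M' ->
  supermartingale Q (fun t => M t + M' t).
Proof.
move=> M0 M'0 smM smM'; split=> [|t].
  by apply: ge0_bounded_below => t; exact: adde_ge0.
by rewrite (le_trans (ge0_upper_expectation_subadd (treeQ t) _ _))// leeD ?smM.2 ?smM'.2.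
Qed.

Lemma supermartingaleZ (c : R) M : (0 < c)%R -> (forall t, 0 <= M t) ->
  supermartingale Q M -> supermartingale Q (fun t => c%:E * M t).
Proof.
move=> c0 M0 smM; split=> [|t].
  by apply: ge0_bounded_below => t; rewrite mule_ge0// lee_fin ltW.
rewrite (upper_expectation_scale (treeQ t))//; last exact: ge0_bounded_below.
by rewrite lee_wpmul2l ?lee_fin ?(ltW c0)// smM.2.
Qed.

Lemma supermartingale_sup (M : nat -> situation X -> \bar R) :
  (forall n t, 0 <= M n t) ->
  (forall t, {homo M^~ t : m n / (m <= n)%N >-> m <= n}) ->
  (forall n, supermartingale Q (M n)) ->
  supermartingale Q (fun t => ereal_sup (range (M ^~ t))).
Proof.
move=> M0 Mnd smM; split=> [|t].
  apply: ge0_bounded_below => t.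
  by apply: le_ereal_sup_tmp; exists (M 0%N t) => //; exists 0%N.
apply: (upper_expectation_sup_le (treeQ t)) => [//|x|n]; first exact: Mnd.
by apply: le_trans ((smM n).2 t) _; apply: ereal_sup_ubound; exists n.
Qed.

(** The slack is a factor because the switching rule compares values up to a factor. Since [1 <= f]
    makes [EV f u] positive, [a] leaves room above it whenever it is finite; otherwise the constant
    [+oo] serves. *)
Lemma near_optimal_supermartingales f (a : R) :
  (1 < a)%R -> (forall w, 1 <= f w) ->
  exists N : situation X -> situation X -> \bar R, forall u,
    [/\ supermartingale Q (N u),
        forall w, cylinder u w -> f w <= path_liminf (N u) w &
        N u u <= a%:E * EV f u].
Proof.
move=> a1 f1.
suff /choice[N HN] : forall u, exists Nu, [/\ supermartingale Q Nu,
    forall w, cylinder u w -> f w <= path_liminf Nu w & Nu u <= a%:E * EV f u].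
  by exists N.
move=> u.
have E1 : 1 <= EV f u by exact: global_upper_expectation_ge.
have E0 : 0 < EV f u by exact: lt_le_trans E1.
have [Efin|] := ltP (EV f u) +oo.
  have : EV f u < a%:E * EV f u.
    have Efn : EV f u \is a fin_num by rewrite ge0_fin_numE// ltW.
    by rewrite lte_pmull// lte_fin.
  by move=> /ereal_inf_lt[_ [M [smM fM] <-] MuE]; exists M; split=> //; exact: ltW.
rewrite leye_eq => /eqP Ey; exists (fun=> +oo); split.
- by split=> [|t]; [exists 0%R => t|]; rewrite leey.
- by move=> w _; rewrite /path_liminf limn_einf_cst leey.
- by rewrite Ey gt0_muley// lte_fin (lt_trans ltr01).
Qed.

End supermartingales.

(** * The switching supermartingale *)

Lemma exists_le_expr (R : realType) (a A : R) : (1 < a)%R ->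
  exists k, (A <= a ^+ k)%R.
Proof.
move=> a1; have a10 : (0 < a - 1)%R by rewrite subr_gt0.
have bernoulli k : (1 + k%:R * (a - 1) <= a ^+ k)%R.
  elim: k => [|k IH]; first by rewrite mul0r addr0 expr0.
  rewrite exprS -natr1; have : (0 <= k%:R * (a - 1) * (a - 1))%R.
    by rewrite !mulr_ge0// ltW.
  by nra.
exists (Num.Def.archi_bound `|A / (a - 1)|%R); apply: le_trans (bernoulli _).
have : (A / (a - 1) < (Num.Def.archi_bound `|A / (a - 1)|)%:R)%R.
  by apply: le_lt_trans (ler_norm _) _; exact: archi_boundP.
by rewrite ltr_pdivrMr//; lra.
Qed.

Section switching.
Context (R : realType) (X : finType) (X_nonempty : (0 < #|X|)%N).
Context (Q : local_models R X) (treeQ : imprecise_probability_tree Q).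
Context (a : R) (a1 : (1 < a)%R).
Context (N : situation X -> situation X -> \bar R).
Implicit Types (t u : situation X) (w : path_space X).

(* The state [(k, u)] means that [N u] is being played, scaled by [a ^+ k];
   the argument is the reversed situation. *)
Fixpoint rev_switch_state (r : seq X) : nat * situation X :=
  if r is _ :: r' then
    let p := rev_switch_state r' in
    if a%:E * N (rev r) (rev r) < N p.2 (rev r) then (p.1.+1, rev r) else p
  else (0%N, [::]).

Definition switch_state t := rev_switch_state (rev t).

Definition switch_process t : \bar R :=
  (a ^+ (switch_state t).1)%:E * N (switch_state t).2 t.

Lemma switch_state_rcons t x : switch_state (rcons t x) =
  if a%:E * N (rcons t x) (rcons t x) < N (switch_state t).2 (rcons t x)
  then ((switch_state t).1.+1, rcons t x) else switch_state t.
Proof. by rewrite /switch_state rev_rcons /= rev_cons revK. Qed.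

Lemma switch_state_prefix t : prefix (switch_state t).2 t.
Proof.
elim/last_ind: t => // t x IH; rewrite switch_state_rcons; case: ifP => _ /=.
  exact: prefix_refl.
exact: prefix_trans IH (prefix_rcons _ _).
Qed.

Lemma switch_count_le_size t : ((switch_state t).1 <= size t)%N.
Proof.
elim/last_ind: t => // t x IH; rewrite switch_state_rcons size_rcons.
by case: ifP => _ //=; exact: leqW.
Qed.

Lemma switch_count_nondecreasing w :
  {homo (fun n => (switch_state (path_prefix w n)).1) : m n / (m <= n)%N >-> (m <= n)%N}.
Proof.
apply: homo_leq => [//|n p q|n]; first exact: leq_trans.
by rewrite path_prefixS switch_state_rcons; case: ifP.
Qed.

Hypothesis N_ge1 : forall u t, prefix u t -> 1 <= N u t.
Hypothesis smN : forall u, supermartingale Q (N u).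

Let a_ge0 : 0 <= a%:E. Proof. by rewrite lee_fin ltW// (lt_trans ltr01). Qed.

Let aX_gt0 k : (0 < a ^+ k)%R. Proof. by rewrite exprn_gt0// (lt_trans ltr01). Qed.

(** At the root and right after a switch, [N t] itself is being played; elsewhere the switching test
    has failed, which is this very bound. *)
Lemma switch_state_le t : N (switch_state t).2 t <= a%:E * N t t.
Proof.
have N0 u : 0 <= N u u by rewrite (le_trans _ (N_ge1 (prefix_refl u))).
have Na u : N u u <= a%:E * N u u by rewrite lee_pemull// lee_fin ltW.
elim/last_ind: t => // t x IH; rewrite switch_state_rcons.
by case: ltP => //= _; exact: Na.
Qed.

Lemma switch_process_ge t : (a ^+ (switch_state t).1)%:E <= switch_process t.
Proof.
by rewrite lee_pemulr ?lee_fin ?(ltW (aX_gt0 _))// N_ge1// switch_state_prefix.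
Qed.

Lemma switch_process_ge0 t : 0 <= switch_process t.
Proof. by apply: le_trans (switch_process_ge t); rewrite lee_fin ltW. Qed.

(** One factor [a] comes from [switch_state_le], the others from the switches, at most one per entry
    of [t]. *)
Lemma switch_process_le t :
  switch_process t <= (a ^+ (size t).+1)%:E * N t t.
Proof.
have N0 : 0 <= N t t by rewrite (le_trans _ (N_ge1 (prefix_refl t))).
apply: (@le_trans _ _ ((a ^+ (switch_state t).1)%:E * (a%:E * N t t))).
  by rewrite lee_wpmul2l ?switch_state_le// lee_fin ltW.
rewrite muleA -EFinM -exprSr lee_wpmul2r// lee_fin ler_eXn2l//.
by rewrite ltnS switch_count_le_size.
Qed.

(** A switch at a child only lowers the value that keeping the current [N u] would give there, so
    each step is dominated by a step of the scaled supermartingale [N u]. *)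
Lemma switch_process_supermartingale : supermartingale Q switch_process.
Proof.
split=> [|t]; first exact/ge0_bounded_below/switch_process_ge0.
have aE_ge0 k : 0 <= (a ^+ k)%:E by rewrite lee_fin ltW.
set p := switch_state t.
have Np x : 0 <= N p.2 (rcons t x).
  rewrite (le_trans _ (N_ge1 _))//.
  exact: prefix_trans (switch_state_prefix t) (prefix_rcons _ _).
apply: (@le_trans _ _ (Q t (fun x => (a ^+ p.1)%:E * N p.2 (rcons t x)))).
  apply: (ge0_upper_expectation_mono (treeQ t)) => x; first exact: switch_process_ge0.
  rewrite /switch_process switch_state_rcons -/p; case: ltP => //= Nlt.
  by rewrite exprSr EFinM -muleA lee_wpmul2l// ltW.
rewrite (upper_expectation_scale (treeQ t)) ?lte_fin//; last exact: ge0_bounded_below.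
by rewrite lee_wpmul2l// (smN _).2.
Qed.

(** The number of switches along [w] is eventually constant or unbounded. If constant, one [N u] is
    played from some time on and [switch_state_le] applies; if unbounded, so is the stake, which
    bounds the process from below. *)
Lemma switch_process_dichotomy w :
  (forall A : R, \forall n \near \oo, A%:E <= switch_process (path_prefix w n)) \/
  exists2 u, cylinder u w & \forall n \near \oo,
    N u (path_prefix w n) <= a%:E * N (path_prefix w n) (path_prefix w n).
Proof.
pose k n := (switch_state (path_prefix w n)).1.
have [[m km]|unbounded] := pselect (exists m, forall n, (m <= n)%N -> k n = k m).
  right; pose p := switch_state (path_prefix w m).
  have stationary n : (m <= n)%N -> switch_state (path_prefix w n) = p.
    elim: n => [|n IH]; first by rewrite leqn0 /p => /eqP ->.
    rewrite leq_eqVlt => /predU1P[<-//|]; rewrite ltnS => mn.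
    (* A switch at this point would raise the count, against [km]. *)
    have := km n.+1 (leqW mn); rewrite /k path_prefixS switch_state_rcons IH//.
    by case: ifP => //= _ /esym/n_Sn.
  exists p.2.
    exact: cylinder_prefix (switch_state_prefix _) (cylinder_path_prefix w m).
  by exists m => // n /= mn; rewrite -{1}(stationary _ mn) switch_state_le.
left=> A; have [j Aj] := exists_le_expr A a1.
have [m jm] : exists m, (j <= k m)%N.
  (* A count that never decreases and never becomes constant passes each [j] in turn. *)
  elim: j {Aj} => [|j [m jm]]; first by exists 0%N.
  apply: contrapT => nj; apply: unbounded; exists m => n mn.
  apply/eqP; rewrite eqn_leq (switch_count_nondecreasing w mn) andbT.
  by apply: leq_trans jm; rewrite leqNgt; apply/negP => jn; apply: nj; exists n.
exists m => // n /= mn; apply: le_trans (switch_process_ge _).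
rewrite lee_fin (le_trans Aj)// ler_eXn2l// (leq_trans jm)//.
exact: switch_count_nondecreasing.
Qed.

End switching.

(** * Levy's zero-one law and continuity from below *)

Section continuity.
Context (R : realType) (X : finType) (X_nonempty : (0 < #|X|)%N).
Context (Q : local_models R X) (treeQ : imprecise_probability_tree Q).

Local Notation EV := (global_upper_expectation Q).

(** The exponent [(size t).+2] adds the near-optimality factor of [N t] to those of
    [switch_process_le]. At a fixed situation this is a constant, which a small weight on [K] can
    absorb. *)
Lemma levy_zero_one (f : path_space X -> \bar R) (a : R) :
  (1 < a)%R -> (forall w, 1 <= f w) ->
  exists K : situation X -> \bar R,
    [/\ supermartingale Q K, forall t, 0 <= K t,
        forall t, K t <= (a ^+ (size t).+2)%:E * EV f t &
        forall w,
          (forall A : R, \forall n \near \oo, A%:E <= K (path_prefix w n)) \/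
          f w <= limn_einf (fun n => (a ^+ 2)%:E * EV f (path_prefix w n))].
Proof.
move=> a1 f1; have [N HN] := near_optimal_supermartingales X_nonempty treeQ a1 f1.
have a0 : (0 < a)%R by rewrite (lt_trans ltr01).
have smN u : supermartingale Q (N u) by case: (HN u).
have fN u w : cylinder u w -> f w <= path_liminf (N u) w by case: (HN u) => _ + _; exact.
have NE u : N u u <= a%:E * EV f u by case: (HN u).
have N_ge1 u t : prefix u t -> 1 <= N u t.
  move=> ut; apply: (supermartingale_ge_liminf X_nonempty treeQ (smN u)) => w tw.
  exact: le_trans (f1 w) (fN _ _ (cylinder_prefix ut tw)).
exists (switch_process a N); split.
- exact: switch_process_supermartingale.
- exact: switch_process_ge0.
- move=> t; apply: le_trans (switch_process_le a1 N_ge1 t) _.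
  rewrite (exprSr _ (size t).+1) EFinM -muleA lee_wpmul2l//.
  by rewrite lee_fin ltW// exprn_gt0.
- move=> w; have [|[u uw uN]] := switch_process_dichotomy a1 N_ge1 w; first by left.
  right; apply: le_trans (fN _ _ uw) _; apply: near_le_limn_einf.
  case: uN => m _ mN; exists m => // n /= mn; apply: le_trans (mN n mn) _.
  by rewrite expr2 EFinM -muleA lee_wpmul2l// lee_fin ltW.
Qed.

Lemma global_upper_expectation_sup_le_ge1 (f_ : nat -> path_space X -> \bar R)
    (f : path_space X -> \bar R) (s : situation X) :
  (forall n w, 1 <= f_ n w) ->
  (forall w, {homo (fun n => f_ n w) : m n / (m <= n)%N >-> m <= n}) ->
  (forall w, f w <= ereal_sup (range (f_ ^~ w))) ->
  EV f s <= ereal_sup (range (fun n => EV (f_ n) s)).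
Proof.
move=> f1 fnd ff; set b := ereal_sup _.
have Eb n : EV (f_ n) s <= b by apply: ereal_sup_ubound; exists n.
have E_ge1 n t : 1 <= EV (f_ n) t by exact: global_upper_expectation_ge.
have E_ge0 n t : 0 <= EV (f_ n) t by exact: le_trans (E_ge1 n t).
have b1 : 1 <= b by exact: le_trans (E_ge1 0%N s) (Eb 0%N).
have [bfin|] := ltP b +oo; last by rewrite leye_eq => /eqP ->; rewrite leey.
have [L bL] : exists L, b = L%:E.
  by exists (fine b); rewrite fineK// ge0_fin_numE// (le_trans _ b1).
have L1 : (1 <= L)%R by rewrite -lee_fin -bL.
apply/lee_addgt0Pr => e e0.
(* The value in [s] will be at most [(1 + eps) ^+ 2 * L + eps * L], hence at most [L + 4 * eps * L]
   as [eps <= 1]. *)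
have [eps [eps0 eps1 epsL]] : exists eps : R, [/\ (0 < eps)%R, (eps <= 1)%R & (4 * eps * L <= e)%R].
  exists (Num.min 1%R (e / (4 * L))%R).
  have eL0 : (0 < e / (4 * L))%R by rewrite divr_gt0// mulr_gt0// (lt_le_trans ltr01).
  rewrite lt_min ltr01 eL0 ge_min lexx; split => //.
  rewrite mulrAC -[leRHS](@divfK _ (4 * L)%R); last by rewrite gt_eqF// mulr_gt0// (lt_le_trans ltr01).
  rewrite mulrC ler_wpM2r//; first by rewrite mulr_ge0// (le_trans ler01).
  by rewrite ge_min lexx orbT.
pose a := (1 + eps)%R; have a1 : (1 < a)%R by rewrite ltrDl.
have a0 : (0 < a)%R by exact: lt_trans a1.
have /choice[K HK] := fun n => levy_zero_one a1 (f1 n).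
have smK n : supermartingale Q (K n) by case: (HK n).
have K0 n t : 0 <= K n t by case: (HK n) => _ + _ _; exact.
have KE n t : K n t <= (a ^+ (size t).+2)%:E * EV (f_ n) t by case: (HK n) => _ _ + _; exact.
(* [c] is the factor of [KE] at [s], so [d n * K n s <= eps * L / 2 ^+ n.+1] and the total cost of
   the [K n] stays below [eps * L]. *)
pose c := (a ^+ (size s).+2)%R; have c0 : (0 < c)%R by rewrite exprn_gt0.
pose d n := (eps / 2 ^+ n.+1 / c)%R.
have d0 n : (0 < d n)%R by rewrite !divr_gt0// exprn_gt0.
pose S n t := \sum_(i < n) (d i)%:E * K i t.
have dK0 n t : 0 <= (d n)%:E * K n t by rewrite mule_ge0// lee_fin ltW.
have S0 n t : 0 <= S n t by apply: sume_ge0.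
have SS n t : S n.+1 t = S n t + (d n)%:E * K n t by rewrite /S big_ord_recr.
have smS n : supermartingale Q (S n).
  elim: n => [|n IH].
    by split=> [|t]; [exists 0%R => t|]; rewrite /S ?big_ord0//;
      under eq_fun do rewrite big_ord0; rewrite (upper_expectation_cst (treeQ t)).
  have -> : S n.+1 = (fun t => S n t + (d n)%:E * K n t) by apply/funext => t.
  by apply: supermartingaleD => //; exact: supermartingaleZ.
have Ss n : S n s <= (eps * (1 - 2 ^- n) * L)%:E.
  elim: n => [|n IH]; first by rewrite /S big_ord0 expr0 invr1 subrr mulr0 mul0r.
  rewrite SS; have -> : (eps * (1 - 2 ^- n.+1) * L = eps * (1 - 2 ^- n) * L + d n * (c * L))%R.
    have e2 : (2 ^- n = 2 * 2 ^- n.+1 :> R)%R by rewrite exprS invfM mulrA divff// mul1r.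
    by rewrite e2 /d; field; rewrite !gt_eqF// exprn_gt0.
  rewrite EFinD; apply: leeD => //; rewrite (EFinM (d n)); apply: lee_wpmul2l.
    by rewrite lee_fin ltW.
  apply: le_trans (KE n s) _; rewrite (EFinM c) -bL; apply: lee_wpmul2l => //.
  by rewrite lee_fin ltW.
(* Both summands grow with [n], so [supermartingale_sup] will apply, and every weighted [K i] enters
   the supremum. *)
pose W n t := (a ^+ 2)%:E * EV (f_ n) t + S n t.
have aE0 n t : 0 <= (a ^+ 2)%:E * EV (f_ n) t by rewrite mule_ge0// lee_fin sqr_ge0.
have W0 n t : 0 <= W n t by exact: adde_ge0.
have smW n : supermartingale Q (W n).
  apply: supermartingaleD => //; apply: supermartingaleZ => //; first by rewrite exprn_gt0.
  apply: global_upper_expectation_supermartingale => // w.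
  exact: le_trans (f1 n w).
have Wnd t : {homo W^~ t : m n / (m <= n)%N >-> m <= n}.
  apply: homo_leq => [//|n p q|n]; first exact: le_trans.
  rewrite /W leeD//; last by rewrite SS leeDl.
  rewrite lee_wpmul2l ?lee_fin ?sqr_ge0//.
  by apply: global_upper_expectation_mono => w; exact: fnd.
pose M t := ereal_sup (range (W^~ t)).
have WM n t : W n t <= M t by apply: ereal_sup_ubound; exists n.
apply: (@le_trans _ _ (M s)).
  apply: ereal_inf_lbound; exists M => //; split.
    exact: supermartingale_sup.
  move=> w _; apply: le_trans (ff w) _; apply: ge_ereal_sup => _ [n _ <-].
  (* If [K n] diverges along [w], its weighted copy drives [M] to [+oo]; otherwise the first summand
     of [W n] alone has a large enough inferior limit. *)
  case: (HK n) => _ _ _ /(_ w)[Ky|/le_trans]; last first.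
    apply; apply: near_le_limn_einf; near=> m.
    by apply: le_trans (WM n _); rewrite leeDl.
  rewrite /path_liminf limn_einf_pinfty ?leey// => A.
  have [m _ Am] := Ky (A / d n)%R; exists m => // k /= mk.
  (* The index is [n.+1] because [S n] stops short of [K n]. *)
  apply: le_trans (WM n.+1 _); rewrite /W SS.
  apply: (@le_trans _ _ ((d n)%:E * K n (path_prefix w k))).
    by rewrite -lee_pdivrMl// muleC -EFinM; exact: Am.
  by rewrite addeA leeDr// adde_ge0.
apply: ge_ereal_sup => _ [n _ <-].
apply: (@le_trans _ _ ((a ^+ 2)%:E * L%:E + (eps * (1 - 2 ^- n) * L)%:E)).
  by rewrite leeD// lee_wpmul2l ?lee_fin ?sqr_ge0// -bL.
rewrite bL -EFinM -!EFinD lee_fin /a.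
have p0 : (0 <= 2 ^- n :> R)%R by rewrite invr_ge0 exprn_ge0.
have L0 : (0 <= L)%R by exact: le_trans L1.
(* This bounds [eps ^+ 2 * L] by [eps * L]; the next fact discards the term with [2 ^- n]. *)
have : (0 <= eps * (1 - eps) * L)%R by rewrite !mulr_ge0 ?subr_ge0// ltW.
have : (0 <= eps * 2 ^- n * L)%R by rewrite !mulr_ge0// ltW.
by move: (2 ^- n)%R => p; lra.
Unshelve. all: by end_near. Qed.

End continuity.

(** Adding a real constant preserves supermartingales, by subadditivity and the axiom on constants.
    One inequality suffices, as it can be applied to [c] and to [- c]. *)
Lemma global_upper_expectation_shift_le (R : realType) (X : finType)
    (Q : local_models R X) (treeQ : imprecise_probability_tree Q)
    (f : path_space X -> \bar R) (c : R) (s : situation X) :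
  global_upper_expectation Q (fun w => f w + c%:E) s <=
  global_upper_expectation Q f s + c%:E.
Proof.
rewrite -leeBlDr//; apply: le_ereal_inf_tmp => _ [M [[[m mM] QM] fM] <-].
rewrite leeBlDr//; apply: ereal_inf_lbound; exists (fun t => M t + c%:E) => //.
split; last first.
  move=> w sw; rewrite addeC; apply: le_trans (leeD2l _ (fM w sw)) _.
  by rewrite /path_liminf -limn_einf_shift//; under eq_fun do rewrite addeC.
have bM : bounded_below M by exists m.
split=> [|t]; first by exists (m + c)%R => t; rewrite EFinD leeD2r.
have bMt : bounded_below (fun x => M (rcons t x)) by exists m.
have bc : bounded_below (fun=> c%:E : \bar R) by move=> T; exists c.
(* With a finite summand, ordinary and dual addition agree. *)
have NyE (x : \bar R) : x + c%:E = (x + c%:E)%dE.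
  by rewrite DualAddTheoryNumDomain.dual_addeE_def// fin_num_adde_defl.
rewrite NyE; under eq_fun do rewrite NyE.
apply: le_trans (upper_expectation_subadd (treeQ t) bMt (bc _)) _.
by rewrite (upper_expectation_cst (treeQ t)) -!NyE leeD2r.
Qed.

Theorem theorem24 (R : realType) (X : finType) (X_nonempty : (0 < #|X|)%N)
    (Q : local_models R X) (treeQ : imprecise_probability_tree Q)
    (s : situation X)
    (f_ : nat -> path_space X -> \bar R) (f : path_space X -> \bar R)
    (f_bounded : forall n, bounded_below (f_ n))
    (f_nondecreasing :
       forall w, {homo (fun n => f_ n w) : m n / (m <= n)%N >-> m <= n})
    (flim_bounded : bounded_below f)
    (f_cvg : forall w, f_ n w @[n --> \oo] --> f w) :
  global_upper_expectation Q (f_ n) s @[n --> \oo] -->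
    global_upper_expectation Q f s.
Proof.
set EV := global_upper_expectation Q.
have EV_nd : {homo (fun n => EV (f_ n) s) : m n / (m <= n)%N >-> m <= n}.
  by move=> m n mn; apply: global_upper_expectation_mono => w; exact: f_nondecreasing.
suff -> : EV f s = ereal_sup (range (fun n => EV (f_ n) s)).
  exact: ereal_nondecreasing_cvgn.
have f_sup w : f w = ereal_sup (range (f_ ^~ w)).
  apply: (cvg_unique _ (f_cvg w)) => //.
  by apply: ereal_nondecreasing_cvgn => m n; exact: f_nondecreasing.
apply/eqP; rewrite eq_le; apply/andP; split; last first.
  apply: ge_ereal_sup => _ [n _ <-]; apply: global_upper_expectation_mono => w.
  by rewrite f_sup; apply: ereal_sup_ubound; exists n.
(* [m] bounds [f_ 0], hence every [f_ n], from below, so each [f_ n + c] is at least 1. *)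
have [m mf] := f_bounded 0%N; pose c := (1 - m)%R.
(* The shift inequality is used for [- c] on [f] here, and for [c] on each [f_ n] at the end. *)
have -> : f = (fun w => (f w + c%:E) + (- c)%:E).
  by apply/funext => w; rewrite EFinN addeK.
apply: le_trans (global_upper_expectation_shift_le treeQ _ _ _) _.
rewrite EFinN leeBlDr//.
apply: (@le_trans _ _ (ereal_sup (range (fun n => EV (fun w => f_ n w + c%:E) s)))).
  apply: (global_upper_expectation_sup_le_ge1 X_nonempty treeQ) => [n w|w n p np|w].
  - have -> : 1 = m%:E + c%:E by rewrite -EFinD subrKC.
    by rewrite leeD2r// (le_trans (mf w))// f_nondecreasing.
  - by rewrite leeD2r// f_nondecreasing.
  - rewrite -leeBrDr// f_sup; apply: ge_ereal_sup => _ [n _ <-].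
    by rewrite leeBrDr//; apply: ereal_sup_ubound; exists n.
apply: ge_ereal_sup => _ [n _ <-].
apply: le_trans (global_upper_expectation_shift_le treeQ _ _ _) _.
by rewrite leeD2r//; apply: ereal_sup_ubound; exists n.
Qed.
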